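(* Let $\psi:\mathbb{R}^n\rightrightarrows\mathbb{R}^n$ be a set-valued mapping such that $\psi(x)$ is nonempty, closed and convex for every $x\in\mathbb{R}^n$. Let $V:\mathbb{R}^n\to\mathbb{R}^n$ be Lipschitz continuous with constant $L>0$ and $\eta$-strongly monotone with $\eta>0$. Let $\mu>0$ and $\rho>0$ be constants such that $$\|P_{\psi(r)}(y)-P_{\psi(s)}(y)\|\le\rho\|r-s\|\quad\text{for all } y,r,s\in\mathbb{R}^n,$$ $$\theta:=\eta-\rho-\tfrac12-\tfrac12L^2-\tfrac12\mu^2+\mu\eta>0,\qquad \sqrt{L^2-2\eta\mu+\mu^2}+\rho<\mu,$$ and put $\theta_1:=\dfrac{\theta}{(2L+\rho+\mu)^2}$. Let $\sigma,\tau$ be real numbers with $$0<\sigma<1,\qquad 0<\tau<\theta_1\cdot\min\left\{\frac{1-\sigma}{4},\ \frac{\sigma^2}{4-\sigma}\right\}.$$ Then, for any initial points $x_0,x_1\in\mathbb{R}^n$, the sequence $\{x_k\}$ defined for $k\ge1$ by $$x_{k+1}=x_k+(1-\sigma)(x_k-x_{k-1})+\tau\Big(P_{\psi(x_k)}\big(V(x_k)-\mu x_k\big)-V(x_k)\Big)$$ converges linearly to the unique solution of the inverse quasi-variational inequality problem for $(V,\psi)$.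
   Context: $\langle\cdot,\cdot\rangle$ and $\|\cdot\|$ are the standard inner product and norm of $\mathbb{R}^n$. For a nonempty closed convex set $C\subset\mathbb{R}^n$, $P_C$ is the metric projection onto $C$. $V$ is $\eta$-strongly monotone if $\langle V(y)-V(z),y-z\rangle\ge\eta\|y-z\|^2$ for all $y,z\in\mathbb{R}^n$. Inverse quasi-variational inequality problem (IQVIP) for $(V,\psi)$: find $x^*\in\mathbb{R}^n$ such that $V(x^* )\in\psi(x^* )$ and $\langle x^*,z-V(x^* )\rangle\ge0$ for all $z\in\psi(x^* )$. A sequence $\{x_k\}$ converges linearly to $x^*$ here means (R-linear convergence) that there exist constants $M>0$ and $q\in(0,1)$ such that $\|x_k-x^*\|\le Mq^k$ for all $k$. *)

(* Defs.v *)
From HB Require Import structures.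
From mathcomp Require Import all_boot all_order all_algebra.
From mathcomp Require Import all_classical all_reals all_analysis.

Set Implicit Arguments.
Unset Strict Implicit.
Unset Printing Implicit Defensive.

Import Order.TTheory GRing.Theory Num.Theory.
Import numFieldNormedType.Exports.

Local Open Scope classical_set_scope.
Local Open Scope ring_scope.

(* Points of R^n are row vectors. The canonical norm [`|x|] on matrices is the
   sup norm, so the Euclidean inner product and norm are defined here. The two
   norms induce the same topology, hence [closed] has its usual meaning. *)
Definition dotv (R : realType) (n : nat) (u v : 'rV[R]_n) : R :=
  \sum_(i < n) u 0 i * v 0 i.

Definition enorm (R : realType) (n : nat) (u : 'rV[R]_n) : R :=
  Num.sqrt (dotv u u).

Definition is_nearest (R : realType) (n : nat) (C : set 'rV[R]_n)
    (y p : 'rV[R]_n) : Prop :=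
  C p /\ forall z, C z -> enorm (y - p) <= enorm (y - z).

(* [get] chooses a point satisfying the predicate when there is one; for C
   nonempty, closed and convex the nearest point exists and is unique. *)
Definition metric_proj (R : realType) (n : nat) (C : set 'rV[R]_n)
    (y : 'rV[R]_n) : 'rV[R]_n :=
  get [set p | is_nearest C y p].

Definition lipschitz_with (R : realType) (n : nat) (L : R)
    (V : 'rV[R]_n -> 'rV[R]_n) : Prop :=
  forall y z, enorm (V y - V z) <= L * enorm (y - z).

Definition strongly_monotone (R : realType) (n : nat) (eta : R)
    (V : 'rV[R]_n -> 'rV[R]_n) : Prop :=
  forall y z, eta * enorm (y - z) ^+ 2 <= dotv (V y - V z) (y - z).

Definition IQVIP_solution (R : realType) (n : nat) (V : 'rV[R]_n -> 'rV[R]_n)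
    (psi : 'rV[R]_n -> set 'rV[R]_n) (xs : 'rV[R]_n) : Prop :=
  psi xs (V xs) /\ forall z, psi xs z -> 0 <= dotv xs (z - V xs).

Definition converges_linearly (R : realType) (n : nat) (x : nat -> 'rV[R]_n)
    (xs : 'rV[R]_n) : Prop :=
  exists M q : R,
    [/\ 0 < M, 0 < q, q < 1 & forall k : nat, enorm (x k - xs) <= M * q ^+ k].

(* Main.v *)
Require Import Defs.
From HB Require Import structures.
From mathcomp Require Import all_boot all_order all_algebra.
From mathcomp Require Import all_classical all_reals all_analysis.
From mathcomp Require Import ring lra.

Import Order.TTheory GRing.Theory Num.Theory.
Import numFieldNormedType.Exports.

Local Open Scope classical_set_scope.
Local Open Scope ring_scope.

(** Solutions of the problem are the zeros of the residual
    [F x = V x - P_{psi x} (V x - mu x)], which is Lipschitz with constant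
    [2L + rho + mu] and [theta]-strongly monotone; such a map has a unique zero
    [xs], found by minimizing [enorm (F x)].  With [e = x_k - xs],
    [d = x_k - x_{k-1}] and [z = e + ((1-sigma)/sigma) d], the iteration reads
    [z' = z - (tau/sigma) F(x_k)], and the energy
    [|z|^2 + ((1-sigma)/sigma^2) |d|^2] decreases geometrically. *)

(** * Euclidean inner product and norm on row vectors *)

Lemma dotvC {R : realType} {n} (u v : 'rV[R]_n) : dotv u v = dotv v u.
Proof. by apply: eq_bigr => i _; rewrite mulrC. Qed.

Lemma dotvDl {R : realType} {n} (u v w : 'rV[R]_n) :
  dotv (u + v) w = dotv u w + dotv v w.
Proof. by rewrite -big_split; apply: eq_bigr => i _; rewrite mxE mulrDl. Qed.

Lemma dotvZl {R : realType} {n} a (u v : 'rV[R]_n) :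
  dotv (a *: u) v = a * dotv u v.
Proof. by rewrite mulr_sumr; apply: eq_bigr => i _; rewrite mxE mulrA. Qed.

Lemma dotvNl {R : realType} {n} (u v : 'rV[R]_n) : dotv (- u) v = - dotv u v.
Proof. by rewrite -scaleN1r dotvZl mulN1r. Qed.

Lemma dotvDr {R : realType} {n} (u v w : 'rV[R]_n) :
  dotv u (v + w) = dotv u v + dotv u w.
Proof. by rewrite dotvC dotvDl !(dotvC u). Qed.

Lemma dotvZr {R : realType} {n} a (u v : 'rV[R]_n) :
  dotv u (a *: v) = a * dotv u v.
Proof. by rewrite dotvC dotvZl dotvC. Qed.

Lemma dotvNr {R : realType} {n} (u v : 'rV[R]_n) : dotv u (- v) = - dotv u v.
Proof. by rewrite dotvC dotvNl dotvC. Qed.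

Definition dotvE := (@dotvDl, @dotvDr, @dotvZl, @dotvZr, @dotvNl, @dotvNr).

Lemma dotv_ge0 {R : realType} {n} (u : 'rV[R]_n) : 0 <= dotv u u.
Proof. by apply: sumr_ge0 => i _; rewrite -expr2 sqr_ge0. Qed.

Lemma enorm_ge0 {R : realType} {n} (u : 'rV[R]_n) : 0 <= enorm u.
Proof. exact: sqrtr_ge0. Qed.

Lemma enorm_sqr {R : realType} {n} (u : 'rV[R]_n) : enorm u ^+ 2 = dotv u u.
Proof. exact/sqr_sqrtr/dotv_ge0. Qed.

Lemma dotv_eq0 {R : realType} {n} (u : 'rV[R]_n) : (dotv u u == 0) = (u == 0).
Proof.
apply/eqP/eqP => [|->]; last by rewrite -(scale0r 0) dotvZl mul0r.
move/psumr_eq0P => H; apply/rowP => i; apply/eqP.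
by rewrite mxE -sqrf_eq0 expr2 H// => j _; rewrite -expr2 sqr_ge0.
Qed.

Lemma enorm_le {R : realType} {n} (u : 'rV[R]_n) a :
  0 <= a -> dotv u u <= a ^+ 2 -> enorm u <= a.
Proof. by move=> a0 ua; rewrite -ler_sqr ?nnegrE ?enorm_ge0// enorm_sqr. Qed.

Lemma ler_enorm {R : realType} {n} (u v : 'rV[R]_n) :
  (enorm u <= enorm v) = (dotv u u <= dotv v v).
Proof. by rewrite -!enorm_sqr ler_sqr ?nnegrE ?enorm_ge0. Qed.

Lemma lipschitz_with_sqr {R : realType} {n} {K} {F : 'rV[R]_n -> 'rV[R]_n} x y :
  0 <= K -> lipschitz_with K F ->
  dotv (F x - F y) (F x - F y) <= K ^+ 2 * dotv (x - y) (x - y).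
Proof.
move=> K0 /(_ x y) H; rewrite -!enorm_sqr -exprMn.
by rewrite ler_sqr ?nnegrE ?mulr_ge0 ?enorm_ge0.
Qed.

Lemma enormZ {R : realType} {n} a (u : 'rV[R]_n) : enorm (a *: u) = `|a| * enorm u.
Proof.
by rewrite /enorm dotvZl dotvZr mulrA -expr2 sqrtrM ?sqr_ge0// sqrtr_sqr.
Qed.

Lemma enormN {R : realType} {n} (u : 'rV[R]_n) : enorm (- u) = enorm u.
Proof. by rewrite /enorm dotvNl dotvNr opprK. Qed.

Lemma enormB {R : realType} {n} (u v : 'rV[R]_n) : enorm (u - v) = enorm (v - u).
Proof. by rewrite -enormN opprB. Qed.

(** Cauchy-Schwarz, obtained by expanding the square of [dotv u u *: v - dotv u v *: u], which
    factors through [dotv u u]. *)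
Lemma dotv_le {R : realType} {n} (u v : 'rV[R]_n) :
  dotv u v <= enorm u * enorm v.
Proof.
have [->|u0] := eqVneq u 0.
  by rewrite -(scale0r 0) dotvZl mul0r mulr_ge0 ?enorm_ge0.
have uu : 0 < dotv u u by rewrite lt_def dotv_eq0 u0 dotv_ge0.
have := dotv_ge0 (dotv u u *: v - dotv u v *: u).
rewrite !dotvE (dotvC v u) => H.
have : 0 <= dotv u u * (dotv u u * dotv v v - dotv u v ^+ 2) by lra.
rewrite pmulr_rge0// subr_ge0 -!enorm_sqr -exprMn => {}H.
apply: le_trans (ler_norm _) _.
by rewrite -ler_sqr ?nnegrE ?mulr_ge0 ?enorm_ge0// (real_normK (num_real _)).
Qed.

Lemma ler_enormD {R : realType} {n} (u v : 'rV[R]_n) :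
  enorm (u + v) <= enorm u + enorm v.
Proof.
apply: enorm_le; first by rewrite addr_ge0 ?enorm_ge0.
rewrite !dotvE (dotvC v u) sqrrD !enorm_sqr.
have := dotv_le u v; lra.
Qed.

Lemma ler_dist_enorm {R : realType} {n} (u v : 'rV[R]_n) :
  `|enorm u - enorm v| <= enorm (u - v).
Proof.
have := ler_enormD (u - v) v; have := ler_enormD (v - u) u.
rewrite !subrK (enormB v u) ler_norml; lra.
Qed.

(** * Comparison with the sup norm, continuity, existence of minimizers *)

Lemma ler_norm_enorm {R : realType} {n} (u : 'rV[R]_n) : `|u| <= enorm u.
Proof.
rewrite [leLHS]/Num.Def.normr/= mx_normrE; apply: bigmax_le => [|[i j] _ /=].
  exact: enorm_ge0.
rewrite -ler_sqr ?nnegrE ?enorm_ge0// enorm_sqr (real_normK (num_real _)) ord1.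
rewrite /dotv (bigD1 j)//= -expr2 lerDl.
by apply: sumr_ge0 => k _; rewrite -expr2 sqr_ge0.
Qed.

Lemma ler_enorm_norm {R : realType} {n} (u : 'rV[R]_n) :
  enorm u <= n%:R * `|u|.
Proof.
apply: enorm_le; first by rewrite mulr_ge0.
apply: (@le_trans _ _ (\sum_(i < n) `|u| ^+ 2)).
  apply: ler_sum => i _; rewrite -expr2 -(real_normK (num_real (u 0 i))) ler_sqr ?nnegrE//.
  rewrite [leRHS]/Num.Def.normr/= mx_normrE.
  exact: (le_bigmax _ (fun ij => `|u ij.1 ij.2|) (ord0, i)).
rewrite sumr_const card_ord exprMn -[leLHS]mulr_natl ler_wpM2r ?sqr_ge0//.
by rewrite -natrX ler_nat; case: n {u} => // n; rewrite expnS leq_pmulr// expn_gt0.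
Qed.

Lemma enorm_lipschitz_continuous {R : realType} {n} (f : 'rV[R]_n -> R) K :
  (forall x y, `|f x - f y| <= K * enorm (x - y)) -> continuous f.
Proof.
move=> fK x; apply/(@cvgrPdist_lt _ _ _ _ (nbhs_filter x)) => e e0.
(* The factor [n] converts the Euclidean norm to the sup norm; the absolute value and the [+ 1] keep
   [K'] positive even when [K <= 0] or [n = 0]. *)
pose K' := `|K| * n%:R + 1.
have K'0 : 0 < K' by rewrite ltr_pwDr// mulr_ge0.
apply/(@nbhs_normP _ 'rV[R]_n); exists (e / K') => [|y /= xy]; first exact: divr_gt0.
apply: le_lt_trans (fK x y) _.
apply: (@le_lt_trans _ _ (K' * `|x - y|)).
  apply: (@le_trans _ _ (`|K| * enorm (x - y))).
    by rewrite ler_wpM2r ?enorm_ge0 ?ler_norm.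
  apply: (@le_trans _ _ (`|K| * (n%:R * `|x - y|))).
    by rewrite ler_wpM2l ?ler_enorm_norm.
  by rewrite mulrA ler_wpM2r// lerDl.
by rewrite mulrC -ltr_pdivlMr.
Qed.

(** The sublevel set of [f x0] in [C] is closed and bounded, hence compact, so [f] attains its
    minimum there; elsewhere in [C] the values exceed [f x0]. *)
Lemma exists_argmin {R : realType} {n} (C : set 'rV[R]_n) (f : 'rV[R]_n -> R)
    x0 M :
  closed C -> C x0 -> continuous f ->
  (forall x, C x -> f x <= f x0 -> enorm x <= M) ->
  exists2 p, C p & forall z, C z -> f p <= f z.
Proof.
move=> clC Cx0 cf bM.
pose S := C `&` f @^-1` [set r | r <= f x0].
have clS : closed S.
  by apply: closedI => //; apply: preimage_closed; [move=> ? _; exact: cf|exact: closed_le].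
have bS : bounded_set S.
  exists M; split; first exact: num_real.
  move=> r Mr x [Cx fx]; apply: le_trans (ler_norm_enorm x) _.
  exact: le_trans (bM x Cx fx) (ltW Mr).
have S0 : S !=set0 by exists x0; split => //=.
have [p] := EVT_min_rV S0 (bounded_closed_compact bS clS) (continuous_subspaceT cf).
rewrite inE => -[Cp fp] minp; exists p => // z Cz.
have [fz|/ltW fz] := leP (f z) (f x0); first by apply: minp; rewrite inE.
exact: le_trans fp fz.
Qed.

(** * Metric projection onto a closed convex set *)

Lemma metric_proj_nearest {R : realType} {n} (C : set 'rV[R]_n) y :
  closed C -> C !=set0 -> is_nearest C y (metric_proj C y).
Proof.
move=> clC [x0 Cx0]; apply: getPex.
have [||p Cp minp] := @exists_argmin R n C (fun z => enorm (y - z)) x0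
    (enorm (y - x0) + enorm y) clC Cx0; last by exists p.
- apply: (@enorm_lipschitz_continuous _ _ _ 1) => u v; rewrite mul1r.
  rewrite (enormB u v); apply: le_trans (ler_dist_enorm _ _) _.
  by rewrite [y - u - _](_ : _ = v - u)// opprB addrC subrKA.
- move=> x Cx yx; have := ler_enormD (x - y) y.
  by rewrite subrK enormB => /le_trans; apply; rewrite lerD2r.
Qed.

(** Moving from [p] towards [z] stays in [C] by convexity and cannot decrease the distance to [y]; a
    positive inner product would make a short step do so. *)
Lemma nearest_dotv_le0 {R : realType} {n} (C : set 'rV[R]_n) y p z :
  convex_set C -> is_nearest C y p -> C z -> dotv (y - p) (z - p) <= 0.
Proof.
move=> cvC [Cp minp] Cz.
have Cseg (t : R) : 0 <= t -> t <= 1 -> C (p + t *: (z - p)).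
  move=> t0 t1; have t01 : Itv.spec (@Itv.num_sem R) (Itv.Real `[0%Z, 1%Z]) t.
    by apply/andP; split; rewrite ?num_real// in_itv/= t0 t1.
  have := cvC z p (Itv.mk t01); rewrite !inE => /(_ Cz Cp).
  have -> // : p + t *: (z - p) = t *: z + (1 - t) *: p.
  by rewrite scalerBl scale1r scalerBr addrCA.
have H (t : R) : 0 <= t -> t <= 1 ->
    2 * t * dotv (y - p) (z - p) <= t ^+ 2 * dotv (z - p) (z - p).
  move=> t0 t1; have := minp _ (Cseg t t0 t1).
  rewrite ler_enorm opprD addrA.
  rewrite [dotv (y - p - _) _]dotvDl !(dotvDr _ _ (- (t *: _))).
  rewrite !dotvNl !dotvNr !dotvZl !dotvZr (dotvC (z - p) (y - p)); lra.
set a := dotv _ _ in H *; set b := dotv _ _ in H.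
rewrite leNgt; apply/negP => a0.
have ab : 2 * a <= b by have := H 1 ler01 (lexx _); lra.
have b0 : 0 < b by lra.
(* This step length minimizes the quadratic [t ^+ 2 * b - 2 * t * a]; it is at most 1 because [H] at
   [t = 1] gives [2 * a <= b]. *)
have := H (a / b).
have -> : 2 * (a / b) * a <= (a / b) ^+ 2 * b = (2 * (a ^+ 2 / b) <= a ^+ 2 / b).
  by congr (_ <= _); field; rewrite gt_eqF.
have := divr_gt0 (exprn_gt0 2 a0) b0 => c0.
move/(_ (divr_ge0 (ltW a0) (ltW b0))); rewrite ler_pdivrMr// mul1r.
have ab' : a <= b by lra.
move/(_ ab'); lra.
Qed.

Section projection.
Context {R : realType} {n : nat} (C : set 'rV[R]_n).
Hypotheses (C0 : C !=set0) (clC : closed C) (cvC : convex_set C).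

Lemma metric_proj_in y : C (metric_proj C y).
Proof. by have [] := metric_proj_nearest C y clC C0. Qed.

Lemma metric_proj_dotv y z :
  C z -> dotv (y - metric_proj C y) (z - metric_proj C y) <= 0.
Proof. exact/nearest_dotv_le0/metric_proj_nearest. Qed.

(** Adding the variational inequalities at the two projections [p], [q] gives [dotv (p - q) (p - q)
    <= dotv (y - z) (p - q)]; Cauchy-Schwarz finishes. *)
Lemma metric_proj_nonexpansive y z :
  enorm (metric_proj C y - metric_proj C z) <= enorm (y - z).
Proof.
set p := metric_proj C y; set q := metric_proj C z.
have := metric_proj_dotv y q (metric_proj_in z).
have := metric_proj_dotv z p (metric_proj_in y).
rewrite -/p -/q => H1 H2.
have H : enorm (p - q) ^+ 2 <= enorm (y - z) * enorm (p - q).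
  rewrite enorm_sqr; apply: le_trans (dotv_le _ _).
  move: H1 H2; rewrite !dotvE; lra.
have [->|pq0] := eqVneq (enorm (p - q)) 0; first exact: enorm_ge0.
by move: H; rewrite expr2 ler_pM2r// lt_def pq0 enorm_ge0.
Qed.

Lemma metric_proj_eq y p :
  p = metric_proj C y <-> C p /\ forall z, C z -> dotv (y - p) (z - p) <= 0.
Proof.
split=> [->|[Cp Hp]].
  by split=> [|z]; [exact: metric_proj_in|exact: metric_proj_dotv].
apply/eqP; rewrite -subr_eq0 -dotv_eq0 eq_le dotv_ge0 andbT.
have := metric_proj_dotv y p Cp; have := Hp _ (metric_proj_in y).
rewrite !dotvE; lra.
Qed.

End projection.

(** * Zeros of strongly monotone Lipschitz maps *)

Section strongly_monotone_lipschitz.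
Context {R : realType} {n : nat} (F : 'rV[R]_n -> 'rV[R]_n) (theta K : R).
Hypotheses (theta_gt0 : 0 < theta) (K_gt0 : 0 < K).
Hypotheses (F_mono : strongly_monotone theta F) (F_lip : lipschitz_with K F).

Lemma strongly_monotone_coercive x y :
  theta * enorm (x - y) <= enorm (F x - F y).
Proof.
have [->|xy0] := eqVneq (enorm (x - y)) 0; first by rewrite mulr0 enorm_ge0.
have xy_gt0 : 0 < enorm (x - y) by rewrite lt_def xy0 enorm_ge0.
rewrite -(ler_pM2r xy_gt0) -mulrA -expr2.
exact: le_trans (F_mono x y) (dotv_le _ _).
Qed.

Lemma strongly_monotone_zero : exists p, F p = 0.
Proof.
have [|x _ Fx|p _ minp] := @exists_argmin R n setT (fun x => enorm (F x)) 0
    (2 * enorm (F 0) / theta) closedT I.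
- apply: (@enorm_lipschitz_continuous _ _ _ K) => x y.
  exact: le_trans (ler_dist_enorm _ _) (F_lip x y).
- rewrite ler_pdivlMr// mulrC -[X in enorm X]subr0.
  apply: le_trans (strongly_monotone_coercive _ _) _.
  have := ler_enormD (F x) (- F 0); rewrite enormN; lra.
(* If [F p != 0], a step of length [t] along [- F p] decreases [enorm (F p)]. *)
exists p; apply/eqP; rewrite -dotv_eq0.
(* Monotonicity and the Lipschitz bound give [enorm (F q) ^+ 2 <= (1 - 2 * theta * t + K ^+ 2 * t ^+
   2) * enorm (F p) ^+ 2]; this [t] minimizes the factor. *)
pose t := theta / K ^+ 2; pose q := p - t *: F p.
have K2 : 0 < K ^+ 2 by exact: exprn_gt0.
have t0 : 0 < t by exact: divr_gt0.
have tK : t * K ^+ 2 = theta by rewrite /t divfK// gt_eqF.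
have qp : q - p = - (t *: F p) by rewrite /q addrAC subrr add0r.
have := minp q I; rewrite ler_enorm.
have := F_mono q p; have := lipschitz_with_sqr q p (ltW K_gt0) F_lip.
rewrite enorm_sqr qp.
rewrite !dotvE (dotvC (F p) (F q)) -tK.
set a := dotv (F p) (F p); set b := dotv (F q) (F p); set c := dotv (F q) (F q).
move=> H1 H2 H3; rewrite eq_le dotv_ge0 andbT -/a.
have a0 : 0 <= a := dotv_ge0 (F p).
have H4 : t * (t * K ^+ 2 * t * a - (a - b)) <= 0 by lra.
rewrite pmulr_rle0// in H4.
have H5 : t ^+ 2 * K ^+ 2 * a <= 0 by lra.
by rewrite -(pmulr_rle0 _ (mulr_gt0 (exprn_gt0 2 t0) K2)).
Qed.

End strongly_monotone_lipschitz.

(** * Energy decay for the inertial iteration *)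

Definition inertial_energy {R : realType} {n} (s : R) (e d : 'rV[R]_n) : R :=
  dotv (e + ((1 - s) / s) *: d) (e + ((1 - s) / s) *: d)
  + (1 - s) / s ^+ 2 * dotv d d.

Section inertial.
Context {R : realType} {n : nat} (s tau theta K : R).
Hypotheses (s_gt0 : 0 < s) (s_lt1 : s < 1) (tau_gt0 : 0 < tau).
Hypotheses (theta_gt0 : 0 < theta).
Hypothesis tau_small : tau * K ^+ 2 * (2 - s) ^+ 2 <= theta * s ^+ 2.

Let s_ge0 : 0 <= s. Proof. exact: ltW. Qed.
Let s_neq0 : s != 0. Proof. by rewrite gt_eqF. Qed.
Let subs_ge0 : 0 <= 1 - s. Proof. by rewrite subr_ge0 ltW. Qed.

Lemma inertial_energy_ge0 (e d : 'rV[R]_n) : 0 <= inertial_energy s e d.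
Proof.
by rewrite addr_ge0 ?dotv_ge0// mulr_ge0 ?dotv_ge0// divr_ge0 ?sqr_ge0.
Qed.

Lemma dotv_le_inertial_energy (e d : 'rV[R]_n) :
  dotv e e <= 2 * inertial_energy s e d.
Proof.
have := dotv_ge0 (e + (2 * ((1 - s) / s)) *: d).
have : 0 <= 2 * ((1 - s) / s) * dotv d d.
  by rewrite mulr_ge0 ?dotv_ge0// mulr_ge0// divr_ge0.
rewrite /inertial_energy !dotvE (dotvC d e).
set a := dotv e e; set b := dotv e d; set c := dotv d d => H1 H2.
rewrite -subr_ge0; apply: le_trans (addr_ge0 H1 H2) _.
by rewrite le_eqVlt; apply/orP; left; apply/eqP; field.
Qed.

Lemma inertial_energy_le (e d : 'rV[R]_n) :
  inertial_energy s e d <=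
    2 * dotv e e + 3 * ((1 - s) / s ^+ 2) * dotv d d.
Proof.
have := dotv_ge0 (e - ((1 - s) / s) *: d).
have : 0 <= 2 * ((1 - s) / s) * dotv d d.
  by rewrite mulr_ge0 ?dotv_ge0// mulr_ge0// divr_ge0.
rewrite /inertial_energy !dotvE (dotvC d e).
set a := dotv e e; set b := dotv e d; set c := dotv d d => H1 H2.
rewrite -subr_ge0; apply: le_trans (addr_ge0 H1 H2) _.
by rewrite le_eqVlt; apply/orP; left; apply/eqP; field.
Qed.

(** Monotonicity yields a decrease of [2 * tau * theta / s * dotv e e], and [tau_small] lets the
    [dotv f f] terms consume at most half of it. Likewise half of the decrease in [dotv d d] pays
    for the cross term with [f]. *)
Lemma inertial_energy_step (e d f : 'rV[R]_n) :
  theta * dotv e e <= dotv e f -> dotv f f <= K ^+ 2 * dotv e e ->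
  inertial_energy s (e + (1 - s) *: d - tau *: f) ((1 - s) *: d - tau *: f) <=
  inertial_energy s e d
    - (tau * theta / s * dotv e e + (1 - s) * (2 - s) / (2 * s) * dotv d d).
Proof.
move=> ef ff.
have s2 : 0 <= 2 - s by move: subs_ge0; lra.
have c1 : 0 <= tau / s by rewrite divr_ge0 ?ltW.
have c2 : 0 <= tau ^+ 2 * (2 - s) ^+ 2 / s ^+ 3.
  by rewrite divr_ge0 ?mulr_ge0 ?exprn_ge0// ltW.
have c3 : 0 <= tau / s ^+ 3 * dotv e e.
  by rewrite mulr_ge0 ?dotv_ge0// divr_ge0 ?exprn_ge0 ?ltW.
have c4 : 0 <= (1 - s) * (2 - s) / (2 * s).
  by rewrite divr_ge0 ?mulr_ge0.
have H1 := ler_wpM2l c1 ef; have H2 := ler_wpM2l c2 ff.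
have H3 := ler_wpM2l c3 tau_small.
(* Young's inequality for the cross term [dotv d f]. *)
have H4 := mulr_ge0 c4 (dotv_ge0 (d + (2 * tau / s) *: f)).
rewrite -subr_ge0.
(* The slack is written as a combination of the differences in [H1], [H2], [H3] and the square in
   [H4], each nonnegative. *)
suff -> : inertial_energy s e d
    - (tau * theta / s * dotv e e + (1 - s) * (2 - s) / (2 * s) * dotv d d)
    - inertial_energy s (e + (1 - s) *: d - tau *: f) ((1 - s) *: d - tau *: f) =
  2 * (tau / s * dotv e f - tau / s * (theta * dotv e e))
  + (tau ^+ 2 * (2 - s) ^+ 2 / s ^+ 3 * (K ^+ 2 * dotv e e)
     - tau ^+ 2 * (2 - s) ^+ 2 / s ^+ 3 * dotv f f)
  + (tau / s ^+ 3 * dotv e e * (theta * s ^+ 2)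
     - tau / s ^+ 3 * dotv e e * (tau * K ^+ 2 * (2 - s) ^+ 2))
  + (1 - s) * (2 - s) / (2 * s)
    * dotv (d + (2 * tau / s) *: f) (d + (2 * tau / s) *: f) by lra.
rewrite /inertial_energy !dotvE (dotvC d e) (dotvC f e) (dotvC f d).
by field.
Qed.

(** The contraction rate: [c] times the upper bound in [inertial_energy_le] must not exceed the
    decrease in [inertial_energy_step]. The two entries serve the [dotv e e] and [dotv d d] terms;
    the second also forces [c < 1]. *)
Let c := Num.min (tau * theta / (2 * s)) (s / 6).

Lemma inertial_energy_contract (e d f : 'rV[R]_n) :
  theta * dotv e e <= dotv e f -> dotv f f <= K ^+ 2 * dotv e e ->
  inertial_energy s (e + (1 - s) *: d - tau *: f) ((1 - s) *: d - tau *: f) <=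
  (1 - c) * inertial_energy s e d.
Proof.
move=> ef ff; apply: le_trans (inertial_energy_step _ _ _ ef ff) _.
have c1 : c <= tau * theta / (2 * s) by rewrite ge_min lexx.
have c2 : c <= s / 6 by rewrite ge_min lexx orbT.
have c0 : 0 <= c.
  by rewrite le_min !divr_ge0 ?mulr_ge0 ?ltW.
have H1 := ler_wpM2l c0 (inertial_energy_le e d).
have H2 := ler_wpM2r (dotv_ge0 e) c1.
have d0 : 0 <= (1 - s) / s ^+ 2 * dotv d d.
  by rewrite mulr_ge0 ?dotv_ge0// divr_ge0 ?exprn_ge0.
have H3 := ler_wpM2r d0 c2.
have b0 : 0 <= (1 - s) * (1 - s) / (2 * s) * dotv d d.
  by rewrite mulr_ge0 ?dotv_ge0// divr_ge0 ?mulr_ge0.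
have E1 : tau * theta / (2 * s) = tau * theta / s / 2 by field.
have E2 : s / 6 * ((1 - s) / s ^+ 2 * dotv d d) = (1 - s) / s * dotv d d / 6.
  by field.
have E3 : (1 - s) * (2 - s) / (2 * s) * dotv d d =
  (1 - s) * (1 - s) / (2 * s) * dotv d d + (1 - s) / s * dotv d d / 2.
  by field.
rewrite E1 in H2; rewrite E2 in H3; rewrite E3; lra.
Qed.

Lemma inertial_converges_linearly (F : 'rV[R]_n -> 'rV[R]_n) xs
    (x : nat -> 'rV[R]_n) :
  0 < K -> strongly_monotone theta F -> lipschitz_with K F -> F xs = 0 ->
  (forall k : nat, (1 <= k)%N ->
     x k.+1 = x k + (1 - s) *: (x k - x k.-1) - tau *: F (x k)) ->
  converges_linearly x xs.
Proof.
move=> K0 F_mono F_lip F0 xE.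
(* The index is shifted because [d] needs a predecessor, so the energy controls [x 1] onwards. *)
pose E k := inertial_energy s (x k.+1 - xs) (x k.+1 - x k).
have c0 : 0 < c by rewrite lt_min !divr_gt0 ?mulr_gt0.
have c1 : c < 1.
  by have : c <= s / 6; [rewrite ge_min lexx orbT | move: s_lt1; lra].
have ES k : E k.+1 <= (1 - c) * E k.
  have := @inertial_energy_contract (x k.+1 - xs) (x k.+1 - x k) (F (x k.+1)).
  have := F_mono (x k.+1) xs; have := lipschitz_with_sqr (x k.+1) xs (ltW K0) F_lip.
  rewrite enorm_sqr F0 subr0.
  rewrite (dotvC (F _)) => h1 h2 /(_ h2 h1).
  rewrite /E (xE k.+1)//=.
  set v := (1 - s) *: _; set w := tau *: _.
  by rewrite [_ - x k.+1]addrC !addrA addNr add0r (addrAC _ (- xs)) (addrAC _ (- xs)).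
have Ek k : E k <= (1 - c) ^+ k * E 0%N.
  elim: k => [|k IH]; first by rewrite expr0 mul1r.
  apply: le_trans (ES k) _; rewrite exprS -mulrA ler_wpM2l//; lra.
(* The energy is quadratic in the error, so the error contracts by the square root. *)
pose q := Num.sqrt (1 - c).
have q0 : 0 < q by rewrite sqrtr_gt0; lra.
have q2 : q ^+ 2 = 1 - c by rewrite sqr_sqrtr//; lra.
have q1 : q < 1 by rewrite -(@ltr_sqr R) ?nnegrE ?ltW// q2 expr1n; lra.
have E0 : 0 <= 2 * E 0%N by rewrite mulr_ge0 ?inertial_energy_ge0.
have xk k : enorm (x k.+1 - xs) <= Num.sqrt (2 * E 0%N) * q ^+ k.
  apply: enorm_le; first by rewrite mulr_ge0 ?sqrtr_ge0 ?exprn_ge0 ?ltW.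
  rewrite exprMn sqr_sqrtr// exprAC q2.
  apply: le_trans (dotv_le_inertial_energy _ (x k.+1 - x k)) _.
  rewrite -mulrA ler_pM2l// mulrC; exact: Ek.
(* The first term covers [x 0], the division by [q] absorbs the index shift, and [+ 1] ensures
   positivity. *)
exists (enorm (x 0%N - xs) + Num.sqrt (2 * E 0%N) / q + 1), q; split=> //.
  by rewrite ltr_pwDr// addr_ge0 ?enorm_ge0// divr_ge0 ?sqrtr_ge0 ?ltW.
have M0 : 0 <= Num.sqrt (2 * E 0%N) / q by rewrite divr_ge0 ?sqrtr_ge0 ?ltW.
case=> [|k]; first by rewrite expr0 mulr1; lra.
apply: le_trans (xk k) _.
have -> : Num.sqrt (2 * E 0%N) * q ^+ k = Num.sqrt (2 * E 0%N) / q * q ^+ k.+1.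
  by rewrite exprS mulrA divfK// gt_eqF.
by rewrite ler_wpM2r ?exprn_ge0 ?ltW//; have := enorm_ge0 (x 0%N - xs); lra.
Qed.

End inertial.

(** * The residual map of the inverse quasi-variational problem *)

Section residual.
Context {R : realType} {n : nat}.
Context (psi : 'rV[R]_n -> set 'rV[R]_n) (V : 'rV[R]_n -> 'rV[R]_n).
Context (L eta mu rho : R).
Hypotheses (psi_neq0 : forall x, psi x !=set0)
  (psi_closed : forall x, closed (psi x))
  (psi_convex : forall x, convex_set (psi x))
  (L_gt0 : 0 < L) (V_lip : lipschitz_with L V)
  (V_mono : strongly_monotone eta V) (mu_gt0 : 0 < mu)
  (psi_proj : forall y r s : 'rV[R]_n,
     enorm (metric_proj (psi r) y - metric_proj (psi s) y)
       <= rho * enorm (r - s)).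

Definition residual x := V x - metric_proj (psi x) (V x - mu *: x).

(** In the variational inequality for the projection, [V x - mu *: x - V x] is [- mu *: x], so
    dividing by [- mu] gives the inequality of the problem. *)
Lemma residual_eq0 x : residual x = 0 <-> IQVIP_solution V psi x.
Proof.
have -> : residual x = 0 <-> V x = metric_proj (psi x) (V x - mu *: x).
  by split=> [/eqP|Vx]; [rewrite subr_eq0 => /eqP|rewrite /residual -Vx subrr].
have E z : (dotv (V x - mu *: x - V x) z <= 0) = (0 <= dotv x z).
  by rewrite addrAC subrr add0r dotvNl dotvZl oppr_le0 pmulr_rge0.
apply: iff_trans (metric_proj_eq _ _ _ _ _ _) _ => //.
by split=> -[Vx H]; split=> // z /H; rewrite E.
Qed.

(** Through the mixed point [metric_proj (psi x) (V y - mu *: y)]: nonexpansiveness handles the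
    change of argument, [psi_proj] the change of set. *)
Lemma proj_residual_dist x y :
  enorm (metric_proj (psi x) (V x - mu *: x) - metric_proj (psi y) (V y - mu *: y))
  <= enorm (V x - V y - mu *: (x - y)) + rho * enorm (x - y).
Proof.
rewrite -(subrKA (metric_proj (psi x) (V y - mu *: y))).
apply: le_trans (ler_enormD _ _) (lerD _ (psi_proj _ _ _)).
have -> : V x - V y - mu *: (x - y) = V x - mu *: x - (V y - mu *: y).
  by apply/rowP => i; rewrite !mxE; ring.
exact: metric_proj_nonexpansive.
Qed.

Lemma residual_lipschitz : lipschitz_with (2 * L + rho + mu) residual.
Proof.
move=> x y.
rewrite /residual opprD addrACA -opprD.
apply: le_trans (ler_enormD _ _) _; rewrite enormN.
have := proj_residual_dist x y.
have := ler_enormD (V x - V y) (- (mu *: (x - y))).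
rewrite enormN enormZ (gtr0_norm mu_gt0).
have := V_lip x y; lra.
Qed.

Lemma residual_strongly_monotone :
  strongly_monotone
    (eta - rho - 1 / 2 - 1 / 2 * L ^+ 2 - 1 / 2 * mu ^+ 2 + mu * eta) residual.
Proof.
move=> x y.
have H1 := proj_residual_dist x y.
rewrite /residual opprD addrACA -opprD dotvDl dotvNl.
set p := metric_proj _ _ - metric_proj _ _ in H1 *.
have H2 := dotv_le p (x - y).
have H3 := ler_wpM2r (enorm_ge0 (x - y)) H1.
set w := V x - V y - mu *: (x - y) in H1 H3.
have H4 : enorm w ^+ 2 <= (L ^+ 2 - 2 * eta * mu + mu ^+ 2) * enorm (x - y) ^+ 2.
  have := lipschitz_with_sqr x y (ltW L_gt0) V_lip.
  have := ler_wpM2l (ltW mu_gt0) (V_mono x y).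
  rewrite !enorm_sqr /w; move: (V x - V y) (x - y) => u d.
  rewrite !dotvE (dotvC d u); lra.
(* The product of [enorm w] and [enorm (x - y)] is at most half the sum of their squares; with [H4]
   this produces the terms of the constant other than [eta - rho]. *)
have H5 := sqr_ge0 (enorm w - enorm (x - y)).
have := V_mono x y; lra.
Qed.

End residual.

Theorem theorem4p1 (R : realType) (n : nat)
    (psi : 'rV[R]_n -> set 'rV[R]_n) (V : 'rV[R]_n -> 'rV[R]_n)
    (L eta mu rho sigma tau : R)
    (psi_neq0 : forall x, psi x !=set0)
    (psi_closed : forall x, closed (psi x))
    (psi_convex : forall x, convex_set (psi x))
    (L_gt0 : 0 < L) (V_lip : lipschitz_with L V)
    (eta_gt0 : 0 < eta) (V_mono : strongly_monotone eta V)
    (mu_gt0 : 0 < mu) (rho_gt0 : 0 < rho)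
    (psi_proj : forall y r s : 'rV[R]_n,
       enorm (metric_proj (psi r) y - metric_proj (psi s) y)
         <= rho * enorm (r - s)) :
  let theta :=
    eta - rho - 1 / 2 - 1 / 2 * L ^+ 2 - 1 / 2 * mu ^+ 2 + mu * eta in
  let theta1 := theta / (2 * L + rho + mu) ^+ 2 in
  0 < theta ->
  Num.sqrt (L ^+ 2 - 2 * eta * mu + mu ^+ 2) + rho < mu ->
  0 < sigma -> sigma < 1 ->
  0 < tau ->
  tau < theta1 * Num.min ((1 - sigma) / 4) (sigma ^+ 2 / (4 - sigma)) ->
  exists xs : 'rV[R]_n,
    [/\ IQVIP_solution V psi xs,
        forall y, IQVIP_solution V psi y -> y = xs
      & forall x : nat -> 'rV[R]_n,
          (forall k : nat, (1 <= k)%N ->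
             x k.+1 = x k + (1 - sigma) *: (x k - x k.-1)
               + tau *: (metric_proj (psi (x k)) (V (x k) - mu *: x k)
                         - V (x k))) ->
          converges_linearly x xs].
Proof.
set K := 2 * L + rho + mu.
move=> theta theta1 theta_gt0 _ sigma_gt0 sigma_lt1 tau_gt0 tau_lt.
have K_gt0 : 0 < K by rewrite /K; lra.
pose F := residual psi V mu.
have F_mono : strongly_monotone theta F by exact: residual_strongly_monotone.
have F_lip : lipschitz_with K F by exact: residual_lipschitz.
have F0E x : F x = 0 <-> IQVIP_solution V psi x by exact: residual_eq0.
have [xs Fxs] := strongly_monotone_zero _ _ _ theta_gt0 K_gt0 F_mono F_lip.
exists xs; split; first exact/F0E.
  (* Strong monotonicity between two zeros of [F] bounds [theta * enorm (y - xs) ^+ 2] by 0. *)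
  move=> y /F0E Fy; apply/eqP; rewrite -subr_eq0 -dotv_eq0 -enorm_sqr.
  have := F_mono y xs; rewrite Fy Fxs subrr -(scale0r 0) dotvZl mul0r.
  by rewrite pmulr_rle0// eq_le sqr_ge0 andbT.
move=> x xE; apply: (inertial_converges_linearly sigma tau theta K _ _ _ _ _ F) => //.
  have : tau < theta1 * (sigma ^+ 2 / (4 - sigma)).
    by apply: lt_le_trans tau_lt _; rewrite ler_pM2l ?divr_gt0 ?exprn_gt0// ge_min lexx orbT.
  have s4 : 0 < 4 - sigma by lra.
  rewrite mulrA ltr_pdivlMr// /theta1 mulrAC ltr_pdivlMr ?exprn_gt0// => H.
  apply: le_trans (ltW H).
  rewrite mulrAC ler_wpM2r ?sqr_ge0// ler_wpM2l ?(ltW tau_gt0)//.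
  (* The bound on [tau] carries [4 - sigma] where [tau_small] has [(2 - sigma) ^+ 2]; they differ by
     [sigma * (1 - sigma) + 2 * sigma]. *)
  have s1 : 0 < sigma * (1 - sigma) by rewrite mulr_gt0 ?subr_gt0.
  lra.
by move=> k /xE ->; rewrite -[_ - V (x k)]opprB scalerN.
Qed.
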